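(* Given any integer $k$, there are infinitely many integers $n$ such that both $n$ and $n+k$ are rational cube sums. In particular, $C+C=\mathbb{Z}$.
   Context: An integer $n$ is called a rational cube sum if there exist rational numbers $\alpha,\beta\in\mathbb{Q}$ with $n=\alpha^3+\beta^3$. $C$ denotes the set of all integers which are rational cube sums, and $C+C=\{c_1+c_2 : c_1,c_2\in C\}$. *)

(* Defs.v *)
From mathcomp Require Import all_boot all_order all_algebra.
From mathcomp Require Import boolp classical_sets functions cardinality.

Set Implicit Arguments.
Unset Strict Implicit.
Unset Printing Implicit Defensive.

Import GRing.Theory.
Local Open Scope classical_set_scope.
Local Open Scope ring_scope.

Definition rational_cube_sum (n : int) : Prop :=
  exists a b : rat, n%:~R = a ^+ 3 + b ^+ 3.

Definition cube_sums : set int := [set n | rational_cube_sum n].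

(* Main.v *)
Require Import Defs.
From mathcomp Require Import all_boot all_order all_algebra.
From mathcomp Require Import boolp classical_sets functions cardinality.
From mathcomp Require Import ring lra zify.

Import Order.TTheory GRing.Theory Num.Theory.
Local Open Scope classical_set_scope.
Local Open Scope ring_scope.

(** The key is an identity going back to Sylvester and Lucas: for rationals
    [u], [v] with [u^2 + uv + v^2 <> 0], the number [uv(u + v)] is a sum of two
    rational cubes ([sum_two_cubes_mul3]).  Taking [u = a / s] and [v = s^2]
    shows that [a (a + s^3)] is a rational cube sum for all integers [a] and
    [s <> 0] ([rational_cube_sum_mul_addX3]).  Now [a (a + s^3)] and
    [(a + 1) (a + 1 + s^3)] differ by [2a + 1 + s^3], which equals [k] for
    [a = (k - 1 - s^3) / 2] as soon as [s] has the parity of [k - 1].  The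
    first number is then [n = ((k - 1)^2 - s^6) / 4], so distinct positive [s]
    of that parity yield distinct [n].  Since cube sums are stable under
    opposite, [k = (n + k) + (- n)] gives [C + C = Z]. *)

Lemma sum_two_cubes_mul3 (F : fieldType) (u v : F) :
    3 != 0 :> F -> u ^+ 2 + u * v + v ^+ 2 != 0 ->
  exists a b : F, u * v * (u + v) = a ^+ 3 + b ^+ 3.
Proof.
move=> F3 D0; pose D := 3 * (u ^+ 2 + u * v + v ^+ 2).
exists ((u ^+ 3 - v ^+ 3 + 6 * u ^+ 2 * v + 3 * u * v ^+ 2) / D).
exists ((v ^+ 3 - u ^+ 3 + 6 * v ^+ 2 * u + 3 * v * u ^+ 2) / D).
by rewrite /D; field; rewrite D0 F3.
Qed.

Lemma rational_cube_sum_mul_addX3 (a s : int) :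
  s != 0 -> rational_cube_sum (a * (a + s ^+ 3)).
Proof.
move=> s0; have s0Q : s%:~R != 0 :> rat by rewrite intr_eq0.
have D0 : (a%:~R / s%:~R) ^+ 2 + a%:~R / s%:~R * s%:~R ^+ 2 +
    (s%:~R ^+ 2) ^+ 2 != 0 :> rat.
  have : 0 < (s%:~R ^+ 2) ^+ 2 :> rat by rewrite exprn_even_gt0 // expf_neq0.
  move: (_ / _) (s%:~R ^+ 2) => u v v0.
  by apply/eqP => uv0; have := sqr_ge0 (u + v / 2); nra.
have [//|x [y xy]] := sum_two_cubes_mul3 rat _ _ _ D0.
by exists x, y; rewrite -xy rmorphM rmorphD rmorphXn /=; field.
Qed.

Lemma rational_cube_sumN (n : int) :
  rational_cube_sum n -> rational_cube_sum (- n).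
Proof.
by move=> [a [b ab]]; exists (- a), (- b); rewrite rmorphN /= ab; ring.
Qed.

Lemma sqrz_parity (x : int) : exists c : int, x ^+ 2 = x + 2 * c.
Proof.
have [q [->|->]] : exists q : int, x = 2 * q \/ x = 2 * q + 1.
  by exists (x %/ 2)%Z; lia.
- by exists (2 * q ^+ 2 - q); ring.
- by exists (2 * q ^+ 2 + q); ring.
Qed.

Lemma infinite_cube_sum_pairs (k : int) :
  infinite_set [set n : int | rational_cube_sum n /\ rational_cube_sum (n + k)].
Proof.
have [c cE] := sqrz_parity (k - 1).
(* A positive integer with the parity of [k - 1], for every [i]. *)
pose s (i : nat) : int := (k - 1) ^+ 2 + 2 * i.+1%:Z.
have s_gt0 i : 0 < s i by rewrite /s; nia.
have s_neq0 i : s i != 0 by rewrite lt0r_neq0.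
have aP i : {a : int | k = 2 * a + 1 + s i ^+ 3}.
  (* [a = (k - 1 - s^3) / 2], the halving being carried out with [c] and [d]. *)
  apply: cid; have [d dE] := sqrz_parity (s i).
  exists (- (c + i.+1%:Z) - d - d * s i).
  have -> : s i ^+ 3 = s i + 2 * d + 2 * d * s i.
    by rewrite exprS dE mulrDr -expr2 dE; ring.
  have -> : s i = k - 1 + 2 * c + 2 * i.+1%:Z by rewrite /s cE.
  by ring.
pose a i := sval (aP i).
have aE i : k = 2 * a i + 1 + s i ^+ 3 := svalP (aP i).
pose n i := a i * (a i + s i ^+ 3).
have n4 i : 4 * n i = (k - 1) ^+ 2 - s i ^+ 6.
  by rewrite [in RHS](aE i) /n; ring.
have n_inj : injective n.
  move=> i j nij.
  have /eqP : s i ^+ 6 = s j ^+ 6 by have := n4 i; have := n4 j; rewrite nij; lia.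
  by rewrite eqrXn2 ?ltW // => /eqP; rewrite /s; lia.
have nP i : rational_cube_sum (n i) /\ rational_cube_sum (n i + k).
  split; first exact: rational_cube_sum_mul_addX3.
  have -> : n i + k = (a i + 1) * (a i + 1 + s i ^+ 3).
    by rewrite [X in _ + X](aE i) /n; ring.
  exact: rational_cube_sum_mul_addX3.
move=> fin; apply: infinite_nat.
have := finite_preimage (in2W n_inj) fin.
by apply: sub_finite_set => i _; exact: nP.
Qed.

Theorem proposition1p20 :
  (forall k : int,
     infinite_set [set n : int | rational_cube_sum n /\ rational_cube_sum (n + k)])
  /\ [set c1 + c2 | c1 in cube_sums & c2 in cube_sums] = [set: int].
Proof.
split=> [|]; first exact: infinite_cube_sum_pairs.
apply/seteqP; split=> // k _.
have [n [nC nkC]] := infinite_setN0 (infinite_cube_sum_pairs k).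
exists (n + k) => //; exists (- n); first exact: rational_cube_sumN.
by rewrite addrC addKr.
Qed.
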